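(* Let $\nu$ be a probability measure on $\mathbb{R}$ with $H(\nu)$ finite, and let $\mu$ be a probability measure on $\mathbb{R}$. Assume that $$\int\log(1+|x|)\,d\nu(x)<\infty\quad\text{and}\quad\int\log(1+|x|)\,d\mu(x)<\infty.$$ Then $$\liminf_{t\to0}\frac{H(\mu*D_{t}^{*}(\nu))}{|\log t|}=\liminf_{t\to0}\frac{H(\mu*D_{t}^{*}(\chi_{[0,1]}))}{|\log t|},$$ where $\chi_{[0,1]}$ denotes the measure $\chi_{[0,1]}(x)\,dx$. In particular, the left-hand side does not depend on $\nu$.
   Context: For $t>0$, $D_t:\mathbb{R}\to\mathbb{R}$ is the dilation $x\mapsto tx$, and $D_t^*(\rho)$ is the push-forward of a measure $\rho$ by $D_t$. For a non-negative measurable function $q$, $H(q(x)\,dx)=\int q(x)\log q(x)\,dx$; this is used even when $q(x)\,dx$ is not a probability measure. The statement $H(\nu)$ finite means that $\nu$ is Lebesgue absolutely continuous and its density $q$ has $\int q\log q\,dx$ finite. *)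

(* Defs.v *)
From HB Require Import structures.
From mathcomp Require Import all_boot all_order all_algebra.
From mathcomp Require Import all_classical all_reals all_analysis.
Set Implicit Arguments. Unset Strict Implicit. Unset Printing Implicit Defensive.
Import Order.TTheory GRing.Theory Num.Theory.
Local Open Scope classical_set_scope.
Local Open Scope ring_scope.
Local Open Scope ereal_scope.

Section defs.
Variable R : realType.
Notation leb := (@lebesgue_measure R).

Definition is_density (rho : set R -> \bar R) (q : R -> R) : Prop :=
  measurable_fun setT q /\ (forall x, (0 <= q x)%R) /\
  (forall A, measurable A -> rho A = \int[leb]_(x in A) (q x)%:E).

(* H(rho) = \int q log q dx for a density q of rho (independent of the
   choice of q, densities being a.e. equal); +oo if rho has no density.
   (Note ln 0 = 0 in MathComp, so q ln q = 0 where q = 0.) *)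
Definition entropy (rho : set R -> \bar R) : \bar R :=
  match pselect (exists q, is_density rho q) with
  | left h => let q := projT1 (cid h) in \int[leb]_x (q x * ln (q x))%:E
  | right _ => +oo
  end.

Definition dilate (t : R) (rho : set R -> \bar R) : set R -> \bar R :=
  fun A => rho ((fun x => t * x)%R @^-1` A).

Definition mconv (mu : set R -> \bar R) (rho : set R -> \bar R)
  : set R -> \bar R :=
  fun A => \int[mu]_y rho ((fun x => x + y)%R @^-1` A).

Definition chi01 : set R -> \bar R := fun A => leb (A `&` `[0%R, 1%R]).

Definition liminf0 (f : R -> \bar R) : \bar R :=
  ereal_sup [set ereal_inf (f @` [set t | (0 < t < d)%R]) | d in [set d | (0 < d)%R]].
End defs.

(* Main.v *)
(* Compare the density [p] of [mu * D_t nu] with [r], the density obtained by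
   smearing [mu] by a Cauchy kernel [w] at scale [t].  Since [w (x + s) / w x] is
   bounded below by a multiple of [(1 + |s|)^-2], the log-moment of [nu] gives
   [\int p ln r = \int ln r dmu + O(1)] uniformly in [t].  By joint convexity of
   relative entropy, [0 <= D(p | r) <= D(nu | w)], which is finite and independent
   of [t].  Hence [H(mu * D_t nu) = \int ln r dmu + O(1)], where the main term does
   not depend on [nu]; apply this to [nu] and to the uniform measure, and divide
   by [|ln t|].  ([D] is relative entropy for measures that need not have equal
   mass, whence the terms [- a + b] in [rel_ent].) *)
Require Import Defs.
From HB Require Import structures.
From mathcomp Require Import all_boot all_order all_algebra.
From mathcomp Require Import all_classical all_reals all_analysis.
From mathcomp Require Import ring lra measurable_realfun.
Set Implicit Arguments.
Unset Strict Implicit.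
Unset Printing Implicit Defensive.
Import Order.TTheory GRing.Theory Num.Theory.
Local Open Scope classical_set_scope.
Local Open Scope ring_scope.
Local Open Scope ereal_scope.

(** * Pointwise bounds for relative entropy, the Cauchy kernel and the logarithm *)

Section scalar_inequalities.
Variable R : realType.
Implicit Types a b l x s t : R.
Local Open Scope ring_scope.

(** Because [ln 0 = 0], the value at [a = 0] is [b], which is also the limit as [a] decreases to
    0. *)
Definition rel_ent a b : R := a * ln a - a * ln b - a + b.

(* [rel_ent a b] is the supremum over [l] of the left-hand side: this
   Legendre form is what makes Jensen's inequality a matter of integrating
   an affine bound. *)
Lemma rel_ent_ge_affine a b l :
  0 <= a -> 0 < b -> a * l + b * (1 - expR l) <= rel_ent a b.
Proof.
rewrite le_eqVlt /rel_ent => /predU1P[<-|a0] b0.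
  have := expR_gt0 l; nra.
(* Multiplied by [a], the tangent bound [1 + x <= expR x] at this point is the claim, since there
   [a * expR x = b * expR l]. *)
have := expR_ge1Dx (l + ln b - ln a).
rewrite expRB expRD !lnK ?posrE// => h.
have : a * (1 + (l + ln b - ln a)) <= a * (expR l * b / a) by rewrite ler_pM2l.
rewrite [leRHS]mulrC divfK ?gt_eqF//; lra.
Qed.

Lemma rel_ent_ge0 a b : 0 <= a -> 0 < b -> 0 <= rel_ent a b.
Proof.
by move=> a0 b0; have := rel_ent_ge_affine 0 a0 b0; rewrite expR0; lra.
Qed.

(** Equality in [rel_ent_ge_affine] at the optimal [l = ln a - ln b]. For [a = 0] the supremum is
    only approached, as [l] tends to minus infinity. *)
Lemma rel_ent_affine a b : 0 < a -> 0 < b ->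
  rel_ent a b = a * (ln a - ln b) + b * (1 - expR (ln a - ln b)).
Proof.
move=> a0 b0; rewrite expRB !lnK ?posrE// /rel_ent.
by field; rewrite gt_eqF.
Qed.

(** Homogeneity of degree one lets the factor [t^-1] of a rescaled kernel pass through relative
    entropy. *)
Lemma rel_entZ a b t : 0 < t -> 0 <= a -> 0 < b ->
  rel_ent (t * a) (t * b) = t * rel_ent a b.
Proof.
rewrite le_eqVlt /rel_ent => t0 /predU1P[<-|a0] b0; first by rewrite !mulr0; ring.
by rewrite !lnM ?posrE//; ring.
Qed.

(** A form of Peetre's inequality; it controls how much a translation changes the Cauchy kernel. *)
Lemma oneDsqrD_le x s : oneDsqr (x + s) <= 2 * (1 + `|s|) ^+ 2 * oneDsqr x.
Proof.
rewrite /oneDsqr -(real_normK (num_real (x + s))) -(real_normK (num_real x)).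
have h : `|x + s| ^+ 2 <= (`|x| + `|s|) ^+ 2.
  by rewrite ler_sqr ?nnegrE ?addr_ge0// ler_normD.
move: h; move: `|x + s| `|x| `|s| (normr_ge0 x) (normr_ge0 s) => y u v u0 v0 h.
rewrite -lerBrDl (le_trans h)//.
have := mulr_ge0 u0 v0; have := sqr_ge0 (u - v); have := sqr_ge0 (u * v).
nra.
Qed.

(** Logarithm of [1 + |x| / t <= (1 + |x|) (1 + t^-1)]; it separates the point from the scale. *)
Lemma lnD_scale_le x t : 0 < t ->
  ln (1 + `|x / t|) <= ln (1 + `|x|) + ln (1 + t^-1).
Proof.
move=> t0; have it0 : 0 < t^-1 by rewrite invr_gt0.
have pos (y : R) : 0 < 1 + `|y| by rewrite ltr_pwDl.
have it1 : 0 < 1 + t^-1 by lra.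
rewrite -lnM ?posrE ?pos// ler_ln ?posrE ?mulr_gt0 ?pos//.
by rewrite normrM (gtr0_norm it0); have := normr_ge0 x; nra.
Qed.

End scalar_inequalities.

(** * Affine change of variables for Lebesgue measure *)

Section affine_change_of_variables.
Variable R : realType.
Notation leb := (@lebesgue_measure R).

Lemma measurable_affine (y t : R) :
  measurable_fun setT ((fun x => y + t * x)%R : measurableTypeR R -> measurableTypeR R).
Proof. by apply: measurable_funD => //; exact: mulrl_measurable. Qed.

(** As a function of [A] the right-hand side is a measure, a scaled push-forward, and it gives each
    half-open interval its length; uniqueness of Lebesgue measure concludes. *)
Lemma lebesgue_measure_affine (y t : R) (A : set R) : (0 < t)%R ->
  measurable A -> leb A = t%:E * leb ((fun x => y + t * x)%R @^-1` A).
Proof.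
move=> t0 mA; pose phi := (fun x => y + t * x)%R : measurableTypeR R -> measurableTypeR R.
have mphi : measurable_fun setT phi by exact: measurable_affine.
pose m := mscale (NngNum (ltW t0)) (pushforward leb phi).
have -> : t%:E * leb (phi @^-1` A) = m mphi A by [].
apply: lebesgue_measure_unique => // X [[a b] _ <-] /=.
rewrite /m /mscale/= /pushforward.
have -> : phi @^-1` `]a, b] = [set` `](a - y) / t, (b - y) / t]%R].
  apply/seteqP; split=> z /=; rewrite !in_itv/= /phi ltr_pdivrMr// ler_pdivlMr//;
   rewrite ltrBlDl lerBrDl [(z * t)%R]mulrC; lra.
rewrite !lebesgue_measure_itv/= !lte_fin ltr_pM2r ?invr_gt0// ltrD2r.
case: ifP => _; last by rewrite mule0.
by rewrite -!EFinD -EFinM; congr EFin; field; rewrite gt_eqF.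
Qed.

Lemma ge0_integral_affine (y t : R) (f : R -> \bar R) : (0 < t)%R ->
  measurable_fun setT f -> (forall x, 0 <= f x) ->
  \int[leb]_x f x = t%:E * \int[leb]_x f (y + t * x)%R.
Proof.
move=> t0 mf f0.
pose phi := (fun x => y + t * x)%R : measurableTypeR R -> measurableTypeR R.
have mphi : measurable_fun setT phi by exact: measurable_affine.
pose m := mscale (NngNum (ltW t0)) (pushforward leb phi).
rewrite (eq_measure_integral (m mphi)); last first.
  by move=> A mA _; exact: lebesgue_measure_affine.
rewrite ge0_integral_mscale//=; congr (_ * _).
by rewrite ge0_integral_pushforward.
Qed.

End affine_change_of_variables.

(** * Entropy and integrals expressed through a density *)

Section densities.
Variable R : realType.
Notation leb := (@lebesgue_measure R).

(** [entropy] works with a density picked by choice. It agrees almost everywhere with [q], as both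
    have the same integral over every measurable set. *)
Lemma entropy_density (rho : set R -> \bar R) (q : R -> R) :
  is_density rho q -> leb.-integrable setT (EFin \o q) ->
  entropy rho = \int[leb]_x (q x * ln (q x))%:E.
Proof.
move=> dq iq; rewrite /entropy; case: pselect => [h|]; last by case; exists q.
case: cid => p [mp [p0 rhop]] /=; have [mq [q0 rhoq]] := dq.
have qp : ae_eq leb setT (EFin \o q) (EFin \o p).
  apply: integral_ae_eq => //; first exact/measurable_EFinP.
  by move=> E _ mE; rewrite -rhop// -rhoq.
have mxlnx (f : R -> R) : measurable_fun setT f ->
    measurable_fun setT (fun x => (f x * ln (f x))%:E).
  move=> mf; apply/measurable_EFinP; apply: measurable_funM => //.
  exact: measurableT_comp.
apply: ae_eq_integral => //; [exact: mxlnx..|].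
by apply: filterS qp => x /= /(_ I)[] ->.
Qed.

(** A measure with a density is dominated by Lebesgue measure, and its Radon-Nikodym derivative
    equals [q] almost everywhere. *)
Lemma ge0_integral_density (nu : probability (measurableTypeR R) R)
    (q f : R -> R) : is_density nu q -> measurable_fun setT f ->
  (forall x, 0 <= f x)%R ->
  \int[nu]_x (f x)%:E = \int[leb]_x (f x * q x)%:E.
Proof.
move=> [mq [q0 nuq]] mf f0.
have dom : nu `<< leb.
  apply/null_content_dominatesP => A mA A0; rewrite nuq//.
  by apply: null_set_integral => //; apply: measurable_funTS; exact/measurable_EFinP.
rewrite -(Radon_Nikodym_SigmaFinite.change_of_variables dom)//; last first.
  exact/measurable_EFinP.
pose g := Radon_Nikodym_SigmaFinite.f nu leb.
have ig : leb.-integrable setT g := Radon_Nikodym_SigmaFinite.f_integrable dom.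
have mg := measurable_int _ ig.
apply: ae_eq_integral => //.
- by apply: emeasurable_funM => //; exact/measurable_EFinP.
- by apply/measurable_EFinP; exact: measurable_funM.
have gq : ae_eq leb setT g (EFin \o q).
  apply: integral_ae_eq => //; first exact/measurable_EFinP.
  move=> E _ mE; rewrite -nuq//; apply/esym.
  exact: (Radon_Nikodym_SigmaFinite.f_integral dom).
by apply: filterS gq => x /= /(_ I) gqx _; rewrite EFinM -gqx.
Qed.

End densities.

(** * The density of the convolution of [mu] with a dilated density *)

Section smearing.
Variables (R : realType) (mu : probability (measurableTypeR R) R).
Notation leb := (@lebesgue_measure R).

(* [mconv] integrates over the default measurable structure of [R], which is not
   convertible to [measurableTypeR R] although both have the same sets. *)
Lemma ge0_mconvE (rho : set R -> \bar R) (A : set R) :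
  measurable_fun setT (fun y : R => rho ((fun x => x + y)%R @^-1` A)) ->
  (forall y, 0 <= rho ((fun x => x + y)%R @^-1` A)) ->
  mconv mu rho A = \int[mu]_y rho ((fun x => x + y)%R @^-1` A).
Proof.
move=> mf f0.
have mid : measurable_fun setT (idfun : measurableTypeR R -> R).
  exact: measurable_id.
by have := ge0_integral_pushforward mid mu measurableT mf (fun x _ => f0 x).
Qed.

(** The convolution of [mu] with the dilated density. It is extended-valued because the integral can
    diverge, though for nonnegative integrable [q] only on a null set of [x]. *)
Definition smear (t : R) (q : R -> R) (x : R) : \bar R :=
  \int[mu]_y (t^-1 * q ((x - y) / t))%:E.

Lemma measurable_smear_kernel (t : R) (q : R -> R) : measurable_fun setT q ->
  measurable_fun setT
    (fun z : measurableTypeR R * measurableTypeR R =>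
       t^-1 * q ((z.1 - z.2) / t))%R.
Proof.
move=> mq; apply: measurable_funM => //; apply: measurableT_comp => //.
apply: measurable_funM => //; exact: measurable_funB.
Qed.

Lemma measurable_smear_kernelr (t : R) (q : R -> R) x : measurable_fun setT q ->
  measurable_fun setT
    (fun y : measurableTypeR R => t^-1 * q ((x - y) / t))%R.
Proof.
move=> mq; apply: measurable_funM => //; apply: measurableT_comp => //.
apply: measurable_funM => //; exact: measurable_funB.
Qed.

Section ge0.
Variables (t : R) (q : R -> R).
Hypotheses (t0 : (0 < t)%R) (mq : measurable_fun setT q).
Hypothesis q0 : forall x, (0 <= q x)%R.

Lemma smear_kernel_ge0 x : (0 <= t^-1 * q x)%R.
Proof. by rewrite mulr_ge0// invr_ge0 ltW. Qed.

Lemma smear_ge0 x : 0 <= smear t q x.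
Proof. by apply: integral_ge0 => y _; rewrite lee_fin smear_kernel_ge0. Qed.

Lemma measurable_smear : measurable_fun setT (smear t q).
Proof.
pose K (z : measurableTypeR R * measurableTypeR R) :=
  (t^-1 * q ((z.1 - z.2) / t))%:E.
have mK : measurable_fun setT K.
  by apply/measurable_EFinP; exact: measurable_smear_kernel.
have K0 z : 0 <= K z by rewrite lee_fin smear_kernel_ge0.
exact: (measurable_fun_fubini_tonelli_F (m2 := mu) K mK K0).
Qed.

(** Tonelli, then the substitution [x = y + t * s] in the inner integral, whose Jacobian [t] cancels
    the factor [t^-1]. *)
Lemma integral_mul_smear (g : R -> R) : measurable_fun setT g ->
  (forall x, 0 <= g x)%R ->
  \int[leb]_x ((g x)%:E * smear t q x) =
  \int[mu]_y \int[leb]_s (g (y + t * s) * q s)%:E.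
Proof.
move=> mg g0.
transitivity (\int[leb]_x \int[mu]_y (g x * (t^-1 * q ((x - y) / t)))%:E).
  apply: eq_integral => x _; rewrite /smear -ge0_integralZl_EFin//.
  - by move=> y _; rewrite lee_fin smear_kernel_ge0.
  - by apply/measurable_EFinP; exact: measurable_smear_kernelr.
pose K (z : measurableTypeR R * measurableTypeR R) :=
  (g z.1 * (t^-1 * q ((z.1 - z.2) / t)))%:E.
have mK : measurable_fun setT K.
  apply/measurable_EFinP; apply: measurable_funM; last exact: measurable_smear_kernel.
  exact: measurableT_comp.
have K0 z : 0 <= K z by rewrite lee_fin mulr_ge0// smear_kernel_ge0.
rewrite (fubini_tonelli (m1 := leb) (m2 := mu) K mK K0).
apply: eq_integral => y _; rewrite /K/= {K mK K0}.
rewrite (ge0_integral_affine y t0); first last.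
- by move=> x; rewrite lee_fin mulr_ge0// smear_kernel_ge0.
- apply/measurable_EFinP; apply: measurable_funM => //.
  apply: measurable_funM => //; apply: measurableT_comp => //.
  by apply: measurable_funM => //; exact: measurable_funB.
rewrite -ge0_integralZl_EFin//; first last.
- exact: ltW.
- apply/measurable_EFinP; apply: measurable_funM.
    by apply: measurableT_comp => //; exact: measurable_affine.
  apply: measurable_funM => //; apply: measurableT_comp => //.
  apply: measurable_funM => //; apply: measurable_funB => //.
  exact: measurable_affine.
- by move=> x _; rewrite lee_fin mulr_ge0// smear_kernel_ge0.
apply: eq_integral => s _; rewrite -EFinM; congr EFin.
have -> : ((y + t * s - y) / t = s)%R by field; rewrite gt_eqF.
by field; rewrite gt_eqF.
Qed.

(** Conservation of mass. Besides [q] itself it serves for the Cauchy kernel and for the pointwise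
    relative entropy of the two. *)
Lemma integral_smear : \int[leb]_x smear t q x = \int[leb]_x (q x)%:E.
Proof.
under eq_integral do rewrite -[smear _ _ _]mul1e.
rewrite (integral_mul_smear (g := cst 1%R))//=.
under eq_integral do under eq_integral do rewrite mul1r.
by rewrite integral_cst//= probability_setT mule1.
Qed.

Hypothesis iq : leb.-integrable setT (EFin \o q).

Lemma integrable_smear : leb.-integrable setT (smear t q).
Proof.
apply/integrableP; split; first exact: measurable_smear.
under eq_integral do rewrite gee0_abs ?smear_ge0//.
by rewrite integral_smear; exact: integrable_lty.
Qed.

Lemma smear_ae_fin : {ae leb, forall x : measurableTypeR R, smear t q x \is a fin_num}.
Proof.
by apply: filterS (integrable_ae measurableT integrable_smear) => x; exact.
Qed.

(** This is [integral_mul_smear] with [g] the indicator of [A]; [fine] changes [smear] only on the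
    null set where it is infinite. *)
Lemma mconv_dilate_density (rho : set R -> \bar R) : is_density rho q ->
  is_density (mconv mu (dilate t rho)) (fine \o smear t q).
Proof.
move=> [_ [_ rhoq]]; split.
  by apply: measurableT_comp => //; exact: measurable_smear.
split=> [x|A mA]; first by rewrite /= fine_ge0// smear_ge0.
have m1A : measurable_fun setT (\1_A : R -> R) by exact: measurable_indic.
have fibre (y : R) : dilate t rho ((fun x => x + y)%R @^-1` A) =
    \int[leb]_s (\1_A (y + t * s) * q s)%:E.
  pose B := [set s : R | A (y + t * s)%R].
  have BE : (fun x => t * x)%R @^-1` ((fun x => x + y)%R @^-1` A) = B.
    by apply/seteqP; split => s /=; rewrite /B/= addrC.
  have mB : measurable B.
    by rewrite -[B]setTI; exact: (@measurable_affine R y t).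
  rewrite /dilate BE rhoq// integral_mkcond; apply: eq_integral => s _.
  rewrite patchE indicE; have -> : (s \in B) = (y + t * s \in A)%R.
    by apply/idP/idP; rewrite !inE.
  by case: (_ \in _); rewrite ?mul1r ?mul0r.
transitivity (\int[leb]_x ((\1_A x)%:E * smear t q x)).
  pose K (z : measurableTypeR R * measurableTypeR R) :=
    (\1_A (z.1 + t * z.2) * q z.2)%:E.
  have mK : measurable_fun setT K.
    apply/measurable_EFinP; apply: measurable_funM; last exact: measurableT_comp.
    apply: measurableT_comp => //; apply: measurable_funD => //.
    exact: measurable_funM.
  have K0 z : 0 <= K z by rewrite lee_fin mulr_ge0.
  (* Tonelli supplies the measurability in [y] that [ge0_mconvE] requires. *)
  have mF := measurable_fun_fubini_tonelli_F (m2 := leb) K mK K0.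
  rewrite ge0_mconvE.
  - rewrite (integral_mul_smear m1A); last by [].
    by apply: eq_integral => y _; exact: fibre.
  - by under eq_fun do rewrite fibre; exact: mF.
  - by move=> y; rewrite fibre; apply: integral_ge0 => s _; rewrite lee_fin mulr_ge0.
rewrite [RHS]integral_mkcond; apply: ae_eq_integral => //.
- apply: emeasurable_funM; first exact/measurable_EFinP.
  exact: measurable_smear.
- apply/(measurable_restrictT _ _).1 => //; apply: measurable_funTS.
  apply/measurable_EFinP; apply: measurableT_comp => //.
  exact: measurable_smear.
- have := smear_ae_fin; apply: filterS => x fx _; rewrite patchE indicE /=.
  by case: (_ \in _); rewrite ?mul1e ?mul0e// fineK.
Qed.

End ge0.
End smearing.

(** * Jensen's inequality for relative entropy *)

Section jensen.
Context d (T : measurableType d) (R : realType).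
Variable mu : {measure set T -> \bar R}.

Lemma measurable_rel_ent (a b : T -> R) :
  measurable_fun setT a -> measurable_fun setT b ->
  measurable_fun setT (fun x => rel_ent (a x) (b x)).
Proof.
move=> ma mb; apply: measurable_funD => //; apply: measurable_funB => //.
by apply: measurable_funB; apply: measurable_funM => //; exact: measurableT_comp.
Qed.

Lemma ge0_integrable (f : T -> R) : measurable_fun setT f ->
  (forall x, 0 <= f x)%R -> \int[mu]_x (f x)%:E < +oo ->
  mu.-integrable setT (EFin \o f).
Proof.
move=> mf f0 fy; apply/integrableP; split; first exact/measurable_EFinP.
by under eq_integral do rewrite /= ger0_norm//.
Qed.

(** The affine bound is integrated for every [l], and then the best [l] for the two integrals is
    chosen. *)
Lemma rel_ent_integral_le (a b : T -> R) :
  mu.-integrable setT (EFin \o a) -> mu.-integrable setT (EFin \o b) ->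
  (forall x, 0 <= a x)%R -> (forall x, 0 < b x)%R ->
  0 < \int[mu]_x (b x)%:E ->
  (rel_ent (fine (\int[mu]_x (a x)%:E)) (fine (\int[mu]_x (b x)%:E)))%:E
  <= \int[mu]_x (rel_ent (a x) (b x))%:E.
Proof.
move=> ia ib a0 b0 ib0.
have ma : measurable_fun setT a by apply/measurable_EFinP; exact: measurable_int ia.
have mb : measurable_fun setT b by apply/measurable_EFinP; exact: measurable_int ib.
have mab := measurable_rel_ent ma mb.
have r0 x : (0 <= rel_ent (a x) (b x))%R by exact: rel_ent_ge0.
set P := fine _; set Q := fine (\int[mu]_x (b x)%:E).
have PE : P%:E = \int[mu]_x (a x)%:E by rewrite fineK// integrable_fin_num.
have QE : Q%:E = \int[mu]_x (b x)%:E by rewrite fineK// integrable_fin_num.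
have P0 : (0 <= P)%R by rewrite -lee_fin PE; apply: integral_ge0 => x _; rewrite lee_fin.
have Q0 : (0 < Q)%R by rewrite -lte_fin QE.
have aff l : (P * l + Q * (1 - expR l))%:E <= \int[mu]_x (rel_ent (a x) (b x))%:E.
  have [iab|] := ltP (\int[mu]_x (rel_ent (a x) (b x))%:E) +oo; last first.
    by rewrite leye_eq => /eqP ->; rewrite leey.
  have ial : mu.-integrable setT (fun x => (l * a x)%:E).
    exact: (integrableZl measurableT l ia).
  have ibl : mu.-integrable setT (fun x => ((1 - expR l) * b x)%:E).
    exact: (integrableZl measurableT (1 - expR l)%R ib).
  have -> : (P * l + Q * (1 - expR l))%:E =
      \int[mu]_x ((l * a x)%:E + ((1 - expR l) * b x)%:E).
    rewrite integralD//.
    have -> : \int[mu]_x (l * a x)%:E = l%:E * P%:E.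
      by rewrite PE -integralZl.
    have -> : \int[mu]_x ((1 - expR l) * b x)%:E = (1 - expR l)%:E * Q%:E.
      by rewrite QE -integralZl.
    by rewrite -!EFinM -EFinD; congr EFin; ring.
  apply: le_integral => //; first exact: integrableD.
    exact: ge0_integrable.
  move=> x _; rewrite -EFinD lee_fin mulrC [((1 - _) * _)%R]mulrC.
  exact: rel_ent_ge_affine.
move: P0; rewrite le_eqVlt => /predU1P[P0|P0]; last first.
  by rewrite rel_ent_affine.
(* When [a] has integral 0 no [l] is optimal; this one makes [Q * (1 - expR l)] equal to [Q - e],
   where [Q = rel_ent 0 Q] is the target. *)
apply/lee_addgt0Pr => e e0; have := aff (ln (e / Q)).
rewrite /rel_ent -P0 !mul0r lnK ?posrE ?divr_gt0// mulrBr mulr1.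
rewrite mulrCA divff ?gt_eqF// mulr1 subrr sub0r oppr0 add0r add0r.
by rewrite EFinB leeBlDr.
Qed.

End jensen.

(** * The Cauchy kernel *)

Section cauchy_kernel.
Variable R : realType.
Notation leb := (@lebesgue_measure R).

(** Left unnormalised, with total mass pi; [rel_ent] accommodates the unequal masses. *)
Definition cauchy (x : R) : R := (oneDsqr x)^-1.

Lemma cauchy_gt0 x : (0 < cauchy x)%R. Proof. by rewrite invr_gt0. Qed.

Lemma cauchy_le1 x : (cauchy x <= 1)%R. Proof. exact: oneDsqrV_le1. Qed.

Lemma measurable_cauchy : measurable_fun setT cauchy.
Proof. by apply: continuous_measurable_fun; exact: continuous_oneDsqrV. Qed.

Lemma integrable_cauchy : leb.-integrable setT (EFin \o cauchy).
Proof.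
apply: ge0_integrable; [exact: measurable_cauchy|by move=> x; rewrite ltW ?cauchy_gt0|].
rewrite ge0_symfun_integralT.
- by rewrite -set_itvcy integral0y_oneDsqr -EFinM ltry.
- by move=> x; rewrite ltW ?cauchy_gt0.
- exact: continuous_oneDsqrV.
- by move=> x; rewrite /cauchy /oneDsqr/= sqrrN.
Qed.

End cauchy_kernel.

(** * The logarithmic potential of [mu] at scale [t] *)

Section log_potential.
Variables (R : realType) (mu : probability (measurableTypeR R) R) (t : R).
Hypothesis t0 : (0 < t)%R.

Definition cauchy_mass (x : R) : R :=
  fine (\int[mu]_y (cauchy ((x - y) / t))%:E).

(** Leaving [t^-1] out of [cauchy_mass] keeps it at most 1, so that [logpot] is nonnegative and
    Tonelli applies to it; the factor returns as [ln t] in the entropy estimate. *)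
Definition logpot (x : R) : R := (- ln (cauchy_mass x))%R.

(** The logarithm of the factor [2 (1 + |s|)^2] of [oneDsqrD_le]. *)
Definition log_shift (s : R) : R := (ln 2 + 2 * ln (1 + `|s|))%R.

Lemma log_shift_ge0 s : (0 <= log_shift s)%R.
Proof. by rewrite addr_ge0 ?mulr_ge0 ?ln_ge0 ?lerDl ?ler1n. Qed.

Lemma integrable_cauchy_kernel x :
  mu.-integrable setT (fun y => (cauchy ((x - y) / t))%:E).
Proof.
apply: (le_integrable measurableT) (finite_measure_integrable_cst mu 1 measurableT).
- apply/measurable_EFinP; apply: measurableT_comp; first exact: measurable_cauchy.
  by apply: measurable_funM => //; exact: measurable_funB.
- move=> y _ /=; rewrite lee_fin normr1 gtr0_norm ?cauchy_gt0//.
  exact: cauchy_le1.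
Qed.

Lemma cauchy_massE x :
  (cauchy_mass x)%:E = \int[mu]_y (cauchy ((x - y) / t))%:E.
Proof. by rewrite fineK// integrable_fin_num//; exact: integrable_cauchy_kernel. Qed.

(** If the integral vanished, the everywhere positive kernel would be zero [mu]-almost everywhere,
    making the whole line [mu]-null. *)
Lemma cauchy_mass_gt0 x : (0 < cauchy_mass x)%R.
Proof.
rewrite -lte_fin cauchy_massE lt_neqAle integral_ge0 ?andbT; last first.
  by move=> y _; rewrite lee_fin ltW ?cauchy_gt0.
apply/eqP => I0.
have mK := measurable_int _ (integrable_cauchy_kernel x).
have : ae_eq mu setT (fun y => (cauchy ((x - y) / t))%:E) (cst 0).
  apply/ae_eq_integral_abs => //; rewrite [RHS]I0.
  by apply: eq_integral => y _; rewrite /= ger0_norm// ltW ?cauchy_gt0.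
move=> [N [mN muN sub]].
have NT : N = setT.
  apply/seteqP; split => // y _; apply: sub => /= /(_ I) [] /eqP.
  by rewrite gt_eqF ?cauchy_gt0.
move: muN; rewrite NT => muT.
have : 1 = 0 :> \bar R by rewrite -muT; exact/esym/probability_setT.
by move/eqP; rewrite onee_eq0.
Qed.

Lemma cauchy_mass_le1 x : (cauchy_mass x <= 1)%R.
Proof.
rewrite -lee_fin cauchy_massE; have <- : \int[mu]_y cst 1%:E y = 1%:E.
  by rewrite integral_cst//= probability_setT mul1e.
apply: ge0_le_integral => //.
- by move=> y _; rewrite lee_fin ltW ?cauchy_gt0.
- exact: measurable_int (integrable_cauchy_kernel x).
- by move=> y _; rewrite lee_fin cauchy_le1.
Qed.

Lemma smear_cauchy x : smear mu t (@cauchy R) x = (t^-1 * cauchy_mass x)%:E.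
Proof.
by rewrite EFinM cauchy_massE -integralZl//; exact: integrable_cauchy_kernel.
Qed.

Lemma logpot_ge0 x : (0 <= logpot x)%R.
Proof. by rewrite oppr_ge0 ln_le0 ?cauchy_mass_le1. Qed.

Lemma measurable_cauchy_mass : measurable_fun setT cauchy_mass.
Proof.
have -> : cauchy_mass = (fun x => t * fine (smear mu t (@cauchy R) x))%R.
  by apply/funext => x; rewrite smear_cauchy/= mulrA divff ?gt_eqF// mul1r.
apply: measurable_funM => //; apply: measurableT_comp => //.
apply: measurable_smear => //; first exact: measurable_cauchy.
by move=> x; rewrite ltW ?cauchy_gt0.
Qed.

Lemma measurable_logpot : measurable_fun setT logpot.
Proof.
apply: measurableT_comp => //; apply: measurableT_comp => //.
exact: measurable_cauchy_mass.
Qed.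

(* The Cauchy kernel has a polynomial tail, so translating it by [s] changes it by
   at most a factor of order [(1 + |s|)^2]. *)
Lemma logpot_shift_le y s : (logpot (y + t * s) <= logpot y + log_shift s)%R.
Proof.
set c : R := (2 * (1 + `|s|) ^+ 2)%R.
have s0 : (0 < 1 + `|s|)%R by rewrite ltr_pwDl.
have c0 : (0 < c)%R by rewrite mulr_gt0 ?exprn_gt0.
have -> : log_shift s = ln c.
  by rewrite /c lnM ?posrE ?exprn_gt0// lnXn// /log_shift mulr_natl.
have le : (cauchy_mass y <= c * cauchy_mass (y + t * s))%R.
  rewrite -lee_fin EFinM !cauchy_massE -integralZl//; last first.
    exact: integrable_cauchy_kernel.
  apply: le_integral => //; first exact: integrable_cauchy_kernel.
    by apply: integrableZl => //; exact: integrable_cauchy_kernel.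
  move=> z _; rewrite lee_fin /cauchy.
  have -> : ((y + t * s - z) / t = (y - z) / t + s)%R by field; rewrite gt_eqF.
  rewrite -ler_pdivrMl// -invfM lef_pV2 ?posrE ?mulr_gt0//.
  by exact: oneDsqrD_le.
have := le; rewrite -ler_ln ?posrE ?mulr_gt0 ?cauchy_mass_gt0//.
rewrite lnM ?posrE ?cauchy_mass_gt0// /logpot; lra.
Qed.

Lemma logpot_le_shift y s : (logpot y <= logpot (y + t * s) + log_shift s)%R.
Proof.
have := logpot_shift_le (y + t * s) (- s).
by rewrite mulrN addrK /log_shift normrN.
Qed.

(** Shifting from 0 by [s = x / t] bounds [logpot x] by [2 ln (1 + |x|)] plus a constant depending
    on [t], so the log-moment of [mu] suffices. *)
Lemma integrable_logpot : \int[mu]_x (ln (1 + `|x|))%:E < +oo ->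
  mu.-integrable setT (EFin \o logpot).
Proof.
move=> mulog.
have mln : measurable_fun setT (fun x : R => ln (1 + `|x|)%R).
  by apply: measurableT_comp => //; exact: measurable_funD.
have ln0 (x : R) : (0 <= ln (1 + `|x|))%R by rewrite ln_ge0// lerDl.
have i1 : mu.-integrable setT (fun x => (ln (1 + `|x|))%:E).
  exact: ge0_integrable.
pose C := (logpot 0 + ln 2 + 2 * ln (1 + t^-1))%R.
pose g (x : R) := (2 * ln (1 + `|x|) + C)%R.
have i2 : mu.-integrable setT (fun x => (2 * ln (1 + `|x|))%:E).
  exact: (integrableZl measurableT 2%R i1).
have i3 := finite_measure_integrable_cst mu C measurableT.
have ig : mu.-integrable setT (EFin \o g) := integrableD measurableT i2 i3.
apply: (le_integrable measurableT) ig.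
  by apply/measurable_EFinP; exact: measurable_logpot.
move=> x _; rewrite lee_fin ger0_norm ?logpot_ge0// (le_trans _ (ler_norm _))//.
have := logpot_shift_le 0 (x / t); rewrite add0r mulrC divfK ?gt_eqF//.
by have := lnD_scale_le x t0; rewrite /g /C /log_shift; lra.
Qed.

End log_potential.

(** * The entropy of the smeared density, up to a bounded error *)

Section entropy_of_smearing.
Variables (R : realType) (mu : probability (measurableTypeR R) R).
Notation leb := (@lebesgue_measure R).
Variable q : R -> R.
Hypotheses (mq : measurable_fun setT q) (q0 : forall x, (0 <= q x)%R).
Hypothesis q1 : \int[leb]_x (q x)%:E = 1.
Hypothesis ient : leb.-integrable setT (fun x => (q x * ln (q x))%:E).
Hypothesis ilog : leb.-integrable setT (fun x => (ln (1 + `|x|) * q x)%:E).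
Hypothesis mulog : \int[mu]_x (ln (1 + `|x|))%:E < +oo.

Let iq : leb.-integrable setT (EFin \o q).
Proof. by apply: ge0_integrable => //; rewrite q1 ltry. Qed.

Lemma integrable_log_shift_density :
  leb.-integrable setT (fun s => (log_shift s * q s)%:E).
Proof.
have i1 : leb.-integrable setT (fun x => (2 * (ln (1 + `|x|) * q x))%:E).
  exact: (integrableZl measurableT 2%R ilog).
have i2 : leb.-integrable setT (fun x => (ln 2 * q x)%:E).
  exact: (integrableZl measurableT (ln 2) iq).
apply: eq_integrable (integrableD measurableT i1 i2) => // x _ /=.
by rewrite -EFinD /log_shift; congr EFin; ring.
Qed.

(** The only term not integrable by hypothesis or by earlier results is [q ln cauchy]; it is
    dominated through [1 + x^2 <= (1 + |x|)^2] by twice the log-moment integrand. *)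
Lemma integrable_rel_ent_density :
  leb.-integrable setT (fun s => (rel_ent (q s) (cauchy s))%:E).
Proof.
have i1 : leb.-integrable setT (fun x => (2 * (ln (1 + `|x|) * q x))%:E).
  exact: (integrableZl measurableT 2%R ilog).
have ilnc : leb.-integrable setT (fun x => (q x * ln (cauchy x))%:E).
  apply: (le_integrable measurableT) i1.
    apply/measurable_EFinP; apply: measurable_funM => //.
    by apply: measurableT_comp => //; exact: measurable_cauchy.
  move=> x _; rewrite lee_fin.
  have h : (0 <= ln (1 + `|x|))%R by rewrite ln_ge0// lerDl.
  have h2 : (0 <= 2 * (ln (1 + `|x|) * q x))%R by rewrite !mulr_ge0.
  rewrite normrM (ger0_norm (q0 x)) (ger0_norm h2).
  rewrite mulrC mulrA ler_wpM2r//.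
  have d1 := oneDsqr_ge1 x; have d0 := lt_le_trans ltr01 d1.
  have x0 : (0 < 1 + `|x|)%R by rewrite ltr_pwDl.
  rewrite /cauchy lnV ?posrE// normrN ger0_norm ?ln_ge0//.
  rewrite mulr_natl -lnXn// ler_ln ?posrE ?exprn_gt0//.
  rewrite /oneDsqr -(real_normK (num_real x)).
  by have := normr_ge0 x; nra.
have i3 := integrableB measurableT (integrableB measurableT
  (integrableB measurableT ient ilnc) iq) (integrableN (integrable_cauchy R)).
apply: eq_integrable i3 => // x _ /=.
by congr EFin; rewrite /rel_ent; ring.
Qed.

Section scale.
Variable t : R.
Hypothesis t0 : (0 < t)%R.

Let p x := fine (smear mu t q x).
Let r x := (t^-1 * cauchy_mass mu t x)%R.

Let mp : measurable_fun setT p.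
Proof. by apply: measurableT_comp => //; exact: measurable_smear. Qed.

Let p0 x : (0 <= p x)%R.
Proof. by rewrite fine_ge0// smear_ge0. Qed.

Let r0 x : (0 < r x)%R.
Proof. by rewrite mulr_gt0 ?invr_gt0// cauchy_mass_gt0. Qed.

Let mr : measurable_fun setT r.
Proof. by apply: measurable_funM => //; exact: measurable_cauchy_mass. Qed.

Let pE : ae_eq leb setT (EFin \o p) (smear mu t q).
Proof.
by have := smear_ae_fin mu t0 mq q0 iq; apply: filterS => x fx _; rewrite /= fineK.
Qed.

Lemma integral_smear_density : \int[leb]_x (p x)%:E = 1.
Proof.
rewrite -q1 -(integral_smear mu t0 mq q0); apply: ae_eq_integral => //.
  exact/measurable_EFinP.
exact: measurable_smear.
Qed.

Lemma integral_smear_cauchy :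
  \int[leb]_x (r x)%:E = \int[leb]_x (cauchy x)%:E.
Proof.
rewrite -(integral_smear mu t0 (@measurable_cauchy R)); last first.
  by move=> x; rewrite ltW ?cauchy_gt0.
by apply: eq_integral => x _; rewrite smear_cauchy.
Qed.

(** At almost every [x], Jensen over [mu] and homogeneity bound the left integrand by the smearing
    of [rel_ent (q s) (cauchy s)]; by [integral_smear] that smearing keeps its integral. *)
Lemma rel_ent_smear_le : \int[leb]_x (rel_ent (p x) (r x))%:E <=
  \int[leb]_x (rel_ent (q x) (cauchy x))%:E.
Proof.
pose h x := rel_ent (q x) (cauchy x).
have mh : measurable_fun setT h.
  by apply: measurable_rel_ent => //; exact: measurable_cauchy.
have h0 x : (0 <= h x)%R by rewrite rel_ent_ge0 ?cauchy_gt0.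
rewrite -(integral_smear mu t0 mh h0); apply: ae_ge0_le_integral => //.
- by move=> x _; rewrite lee_fin rel_ent_ge0.
- by apply/measurable_EFinP; exact: measurable_rel_ent.
- by move=> x _; exact: smear_ge0.
- exact: measurable_smear.
have := smear_ae_fin mu t0 mq q0 iq; apply: filterS => x fx _.
pose a (y : R) := (t^-1 * q ((x - y) / t))%R.
pose b (y : R) := (t^-1 * cauchy ((x - y) / t))%R.
have ia : mu.-integrable setT (EFin \o a).
  apply: ge0_integrable.
  - exact: measurable_smear_kernelr.
  - by move=> y; exact: smear_kernel_ge0.
  - by move: fx; rewrite ge0_fin_numE ?smear_ge0.
have ib : mu.-integrable setT (EFin \o b).
  exact: (integrableZl measurableT t^-1 (integrable_cauchy_kernel mu t x)).
have sb : \int[mu]_y (b y)%:E = (r x)%:E by rewrite -smear_cauchy.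
have b0 y : (0 < b y)%R by rewrite mulr_gt0 ?invr_gt0 ?cauchy_gt0.
have a0 y : (0 <= a y)%R by exact: smear_kernel_ge0.
have ib0 : 0 < \int[mu]_y (b y)%:E by rewrite sb lte_fin.
have := rel_ent_integral_le ia ib a0 b0 ib0; rewrite sb /=.
move/le_trans; apply; rewrite le_eqVlt; apply/orP; left; apply/eqP.
apply: eq_integral => y _; rewrite /a /b /h rel_entZ ?invr_gt0 ?cauchy_gt0//.
Qed.

Let inner y : \bar R := \int[leb]_s (logpot mu t (y + t * s) * q s)%:E.

Let mlogpot_affine y :
  measurable_fun setT (fun s => (logpot mu t (y + t * s) * q s)%:E).
Proof.
apply/measurable_EFinP; apply: measurable_funM => //.
apply: measurableT_comp; first exact: measurable_logpot.
exact: measurable_affine.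
Qed.

Let minner : measurable_fun setT inner.
Proof.
pose K (z : measurableTypeR R * measurableTypeR R) :=
  (logpot mu t (z.1 + t * z.2) * q z.2)%:E.
have mK : measurable_fun setT K.
  apply/measurable_EFinP; apply: measurable_funM; last exact: measurableT_comp.
  apply: measurableT_comp; first exact: measurable_logpot.
  by apply: measurable_funD => //; exact: measurable_funM.
have K0 z : 0 <= K z by rewrite lee_fin mulr_ge0// logpot_ge0.
exact: (measurable_fun_fubini_tonelli_F (m2 := leb) K mK K0).
Qed.

Let inner_ge0 y : 0 <= inner y.
Proof. by apply: integral_ge0 => s _; rewrite lee_fin mulr_ge0// logpot_ge0. Qed.

(** Free of [t] and of [mu], which is what makes the error uniform in [t]. *)
Let shift_cost := \int[leb]_s (log_shift s * q s)%:E.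

Let shift_cost_ge0 : 0 <= shift_cost.
Proof. by apply: integral_ge0 => s _; rewrite lee_fin mulr_ge0// log_shift_ge0. Qed.

Let mshift : measurable_fun setT (fun s => (log_shift s * q s)%:E).
Proof. exact: measurable_int integrable_log_shift_density. Qed.

Let integral_constM (c : R) : (0 <= c)%R -> \int[leb]_s (c * q s)%:E = c%:E.
Proof.
move=> c0; under eq_integral do rewrite EFinM.
rewrite ge0_integralZl_EFin// ?q1 ?mule1//; last exact/measurable_EFinP.
by move=> x _; rewrite lee_fin.
Qed.

Let inner_le y : inner y <= (logpot mu t y)%:E + shift_cost.
Proof.
rewrite -(integral_constM (logpot_ge0 mu t y)) -ge0_integralD//.
- apply: ge0_le_integral => //.
  + by move=> s _; rewrite lee_fin mulr_ge0// logpot_ge0.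
  + exact: mlogpot_affine.
  + apply: emeasurable_funD => //; apply/measurable_EFinP; exact: measurable_funM.
  + by move=> s _; rewrite -EFinD lee_fin -mulrDl ler_wpM2r// logpot_shift_le.
- by move=> s _; rewrite lee_fin mulr_ge0// logpot_ge0.
- by apply/measurable_EFinP; exact: measurable_funM.
- by move=> s _; rewrite lee_fin mulr_ge0// log_shift_ge0.
Qed.

Let le_inner y : (logpot mu t y)%:E <= inner y + shift_cost.
Proof.
rewrite -(integral_constM (logpot_ge0 mu t y)) -ge0_integralD//.
- apply: ge0_le_integral => //.
  + by move=> s _; rewrite lee_fin mulr_ge0// logpot_ge0.
  + by apply/measurable_EFinP; exact: measurable_funM.
  + by apply: emeasurable_funD => //; exact: mlogpot_affine.
  + by move=> s _; rewrite -EFinD lee_fin -mulrDl ler_wpM2r// logpot_le_shift.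
- by move=> s _; rewrite lee_fin mulr_ge0// logpot_ge0.
- exact: mlogpot_affine.
- by move=> s _; rewrite lee_fin mulr_ge0// log_shift_ge0.
Qed.

Let mulogpot := \int[mu]_y (logpot mu t y)%:E.

Let mconst (c : \bar R) : 0 <= c -> \int[mu]_y cst c y = c.
Proof. by move=> c0; rewrite integral_cst//= probability_setT mule1. Qed.

Lemma integral_logpot_smear :
  \int[leb]_x (logpot mu t x * p x)%:E = \int[mu]_y inner y.
Proof.
rewrite -(integral_mul_smear mu t0 mq q0 (measurable_logpot mu t0)); last first.
  by move=> x; exact: logpot_ge0.
apply: ae_eq_integral => //.
- by apply/measurable_EFinP; apply: measurable_funM => //; exact: measurable_logpot.
- apply: emeasurable_funM; last exact: measurable_smear.
  by apply/measurable_EFinP; exact: measurable_logpot.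
by apply: filterS pE => x /= /(_ I) <- _; rewrite EFinM.
Qed.

Lemma logpot_smear_le :
  \int[leb]_x (logpot mu t x * p x)%:E <= mulogpot + shift_cost.
Proof.
rewrite integral_logpot_smear -[shift_cost]mconst// -ge0_integralD//.
- apply: ge0_le_integral => //; apply: emeasurable_funD => //.
  by apply/measurable_EFinP; exact: measurable_logpot.
- by move=> y _; rewrite lee_fin logpot_ge0.
- by apply/measurable_EFinP; exact: measurable_logpot.
Qed.

(** Stated with a sum rather than a difference, so that every integral involved is of a nonnegative
    function. *)
Lemma logpot_smear_ge :
  mulogpot <= \int[leb]_x (logpot mu t x * p x)%:E + shift_cost.
Proof.
rewrite integral_logpot_smear -[shift_cost]mconst// -ge0_integralD//.
apply: ge0_le_integral => //.
- by move=> y _; rewrite lee_fin logpot_ge0.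
- by apply/measurable_EFinP; exact: measurable_logpot.
- exact: emeasurable_funD.
Qed.

(** Here [e = F + 1 - ln t - G - W], with [F] the relative entropy of [p] and [r], [G] the integral
    of [logpot] against [p], and [W] the Cauchy mass. [F] lies between 0 and its unsmeared value,
    and [G] is within [shift_cost] of [mulogpot]. *)
Lemma entropy_smear_bound (rho : set R -> \bar R) : is_density rho q ->
  exists2 e : R, entropy (mconv mu (dilate t rho)) = e%:E &
    (`|e + fine mulogpot + ln t| <=
      fine (\int[leb]_x (rel_ent (q x) (cauchy x))%:E)%E + fine shift_cost
      + 1 + fine (\int[leb]_x (cauchy x)%:E)%E)%R.
Proof.
move=> dq.
have fPhi : \int[leb]_x (rel_ent (q x) (cauchy x))%:E \is a fin_num :=
  integrable_fin_num measurableT integrable_rel_ent_density.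
have fA : shift_cost \is a fin_num :=
  integrable_fin_num measurableT integrable_log_shift_density.
have fL : mulogpot \is a fin_num :=
  integrable_fin_num measurableT (integrable_logpot t0 mulog).
have fW : \int[leb]_x (cauchy x)%:E \is a fin_num :=
  integrable_fin_num measurableT (integrable_cauchy R).
have W0 : 0 <= \int[leb]_x (cauchy x)%:E.
  by apply: integral_ge0 => x _; rewrite lee_fin ltW ?cauchy_gt0.
have Phi0 : 0 <= \int[leb]_x (rel_ent (q x) (cauchy x))%:E.
  by apply: integral_ge0 => x _; rewrite lee_fin rel_ent_ge0 ?cauchy_gt0.
have ip : leb.-integrable setT (fun x => (p x)%:E).
  by apply: ge0_integrable => //; rewrite integral_smear_density ltry.
have ir : leb.-integrable setT (fun x => (r x)%:E).
  apply: ge0_integrable => //; first by move=> x; rewrite ltW.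
  by rewrite integral_smear_cauchy -ge0_fin_numE.
have iF : leb.-integrable setT (fun x => (rel_ent (p x) (r x))%:E).
  apply: ge0_integrable.
  - exact: measurable_rel_ent.
  - by move=> x; exact: rel_ent_ge0.
  - by rewrite (le_lt_trans rel_ent_smear_le)// -ge0_fin_numE.
have iG : leb.-integrable setT (fun x => (logpot mu t x * p x)%:E).
  apply: ge0_integrable.
  - by apply: measurable_funM => //; exact: measurable_logpot.
  - by move=> x; rewrite mulr_ge0// logpot_ge0.
  - by rewrite (le_lt_trans logpot_smear_le)// ltey_eq fin_numD fL fA.
have Fle := rel_ent_smear_le; have Gle := logpot_smear_le; have Gge := logpot_smear_ge.
have F0 : 0 <= \int[leb]_x (rel_ent (p x) (r x))%:E.
  by apply: integral_ge0 => x _; rewrite lee_fin rel_ent_ge0.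
have fF := integrable_fin_num measurableT iF.
have fG := integrable_fin_num measurableT iG.
rewrite (entropy_density (mconv_dilate_density mu t0 mq q0 iq dq))//.
(* Pointwise [p ln p = rel_ent p r + p ln r + p - r], where [ln r = - ln t - logpot]. *)
have -> : \int[leb]_x ((fine \o smear mu t q) x * ln ((fine \o smear mu t q) x))%:E =
  \int[leb]_x (((rel_ent (p x) (r x))%:E + ((1 - ln t) * p x)%:E)
               - ((logpot mu t x * p x)%:E + (r x)%:E)).
  apply: eq_integral => x _; congr EFin.
  rewrite /= -/(p x) /rel_ent /r /logpot.
  by rewrite lnM ?posrE ?invr_gt0 ?cauchy_mass_gt0// lnV ?posrE//; ring.
have ip' : leb.-integrable setT (fun x => ((1 - ln t) * p x)%:E).
  exact: (integrableZl measurableT (1 - ln t)%R ip).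
have Ep' : \int[leb]_x ((1 - ln t) * p x)%:E = (1 - ln t)%:E.
  rewrite -[RHS]mule1 -integral_smear_density -integralZl//.
have i1 := integrableD measurableT iF ip'.
have i2 := integrableD measurableT iG ir.
rewrite (integralB measurableT i1 i2) integralD// integralD//.
rewrite Ep' integral_smear_cauchy.
move: fPhi fA fL fW fF fG Fle Gle Gge F0 W0 shift_cost_ge0.
move: (\int[leb]_x (rel_ent (p x) (r x))%:E) (\int[leb]_x (cauchy x)%:E)
  (\int[leb]_x (logpot mu t x * p x)%:E) (\int[leb]_x (rel_ent (q x) (cauchy x))%:E).
move=> F W G Phi /fineK <- /fineK <- /fineK <- /fineK <- /fineK <- /fineK <- /=.
rewrite -!EFinD !lee_fin => FP GL LG F0 W0 A0.
exists (fine F + (1 - ln t) - (fine G + fine W))%R => //.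
rewrite ler_norml; lra.
Qed.

End scale.

(** The previous bound does not mention [t], so one constant serves all scales; the centre depends
    on [mu] and [t] but not on [q]. *)
Lemma entropy_smear_bounded (rho : set R -> \bar R) : is_density rho q ->
  exists C : R, forall t : R, (0 < t)%R ->
  exists2 e : R, entropy (mconv mu (dilate t rho)) = e%:E &
    (`|e + fine (\int[mu]_y (logpot mu t y)%:E)%E + ln t| <= C)%R.
Proof. by move=> dq; eexists => t t0; exact: entropy_smear_bound. Qed.

End entropy_of_smearing.

(** * Comparison of lower limits, and the conclusion *)

(** A bounded difference disappears after division by [|ln t|], which tends to infinity at 0. *)
Lemma liminf0_div_ln_le (R : realType) (f g : R -> \bar R) (C : R) :
  (forall t, (0 < t)%R -> exists a b : R,
    [/\ f t = a%:E, g t = b%:E & (`|a - b| <= C)%R]) ->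
  liminf0 (fun t => f t * (`|ln t|^-1)%:E) <=
  liminf0 (fun t => g t * (`|ln t|^-1)%:E).
Proof.
move=> fg; apply: ge_ereal_sup => _ [d /= d0 <-].
have C0 : (0 <= C)%R.
  by have [a [b [_ _]]] := fg 1%R ltr01; apply: le_trans.
apply/lee_addgt0Pr => e e0; rewrite -leeBlDr//.
(* Below this threshold [C / e < |ln t|], so the two quotients differ by less than [e]. *)
pose d1 := Num.min d (expR (- (C / e))).
have d10 : (0 < d1)%R by rewrite lt_min d0 expR_gt0.
apply: le_trans (ereal_sup_ubound (ex_intro2 _ _ d1 d10 erefl)).
apply: le_ereal_inf_tmp => _ [t tI <-].
have /andP[t0] : (0 < t < d1)%R := tI; rewrite lt_min => /andP[td te].
rewrite leeBlDr//; apply: le_trans.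
  by apply: ereal_inf_lbound; exists t => //=; rewrite t0 td.
have [a [b [-> -> abC]]] := fg t t0.
have lnt : (C / e < `|ln t|)%R.
  have : (ln t < - (C / e))%R by rewrite -ltr_expR lnK ?posrE.
  have := divr_ge0 C0 (ltW e0); have := ler_norm (- ln t); rewrite normrN; lra.
have l0 : (0 < `|ln t|)%R by rewrite (le_lt_trans _ lnt)// divr_ge0// ltW.
rewrite -!EFinM -EFinD lee_fin ler_pdivrMr// mulrDl divfK ?gt_eqF//.
move: lnt; rewrite ltr_pdivrMr// => lnt.
by have := ler_norm (a - b); nra.
Qed.

Theorem theorem2p7 (R : realType) (nu mu : probability (measurableTypeR R) R) :
  entropy nu \is a fin_num ->
  \int[nu]_x (ln (1 + `|x|))%:E < +oo ->
  \int[mu]_x (ln (1 + `|x|))%:E < +oo ->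
  liminf0 (fun t : R => entropy (mconv mu (dilate t nu)) * (`|ln t|^-1)%:E)
  = liminf0 (fun t : R => entropy (mconv mu (dilate t (@chi01 R))) * (`|ln t|^-1)%:E).
Proof.
move=> Hnu nulog mulog; pose leb := @lebesgue_measure R.
(* Without a density [entropy nu] would be [+oo], against [Hnu]. *)
have [q dq] : exists q, is_density nu q.
  by move: Hnu; rewrite /entropy; case: pselect.
have [mq [q0 nuq]] := dq.
have q1 : \int[leb]_x (q x)%:E = 1 by rewrite -nuq// probability_setT.
have iq : leb.-integrable setT (EFin \o q).
  by apply: ge0_integrable => //; rewrite q1 ltry.
have ient : leb.-integrable setT (fun x => (q x * ln (q x))%:E).
  have mqlnq : measurable_fun setT (fun x => q x * ln (q x))%R.
    by apply: measurable_funM => //; exact: measurableT_comp.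
  apply/integrableP; split; first exact/measurable_EFinP.
  (* A measurable function with finite integral is absolutely integrable. *)
  by rewrite integral_fin_num_abs// -(entropy_density dq iq).
have mlog : measurable_fun setT (fun x : R => ln (1 + `|x|))%R.
  by apply: measurableT_comp => //; exact: measurable_funD.
have log0 (x : R) : (0 <= ln (1 + `|x|))%R by rewrite ln_ge0// lerDl.
have ilog : leb.-integrable setT (fun x => (ln (1 + `|x|) * q x)%:E).
  apply: ge0_integrable.
  - exact: measurable_funM.
  - by move=> x; rewrite mulr_ge0.
  - by rewrite -(ge0_integral_density dq).
pose u : R -> R := \1_`[0%R, 1%R].
have mu01 : measurable_fun setT u by exact: measurable_indic.
have u0 x : (0 <= u x)%R by rewrite /u indicE.
have uint A : measurable A -> @chi01 R A = \int[leb]_(x in A) (u x)%:E.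
  by move=> mA; rewrite integral_indic// setIC.
have du : is_density (@chi01 R) u by split=> //; split.
have u1 : \int[leb]_x (u x)%:E = 1.
  have leb01 : leb [set` `[0%R, 1%R]] = 1.
    by rewrite /leb lebesgue_measure_itv/= lte_fin ltr01 sube0.
  by rewrite -uint// /chi01 setTI.
(* The integrand is identically zero, as [u] takes only the values 0 and 1. *)
have uent : leb.-integrable setT (fun x => (u x * ln (u x))%:E).
  apply: eq_integrable (integrable0 leb setT) => // x _ /=.
  by rewrite /u indicE; case: (_ \in _); rewrite ?ln1 ?mulr0 ?mul0r.
have ulog : leb.-integrable setT (fun x => (ln (1 + `|x|) * u x)%:E).
  have iu : leb.-integrable setT (fun x => (ln 2 * u x)%:E).
    have iu1 : leb.-integrable setT (EFin \o u).
      by apply: ge0_integrable => //; rewrite u1 ltry.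
    exact: (integrableZl measurableT (ln 2) iu1).
  apply: (le_integrable measurableT) iu.
    by apply/measurable_EFinP; exact: measurable_funM.
  have ln2 : (0 <= ln 2 :> R)%R by rewrite ln_ge0 ?ler1n.
  move=> x _; rewrite lee_fin !normrM (ger0_norm ln2) (ger0_norm (log0 x)).
  rewrite (ger0_norm (u0 x)).
  rewrite /u indicE; have [|_] := boolP (x \in _); last by rewrite !mulr0.
  rewrite inE/= in_itv/= => /andP[x0 x1]; rewrite !mulr1.
  by rewrite ler_ln ?posrE ?ltr_pwDl// ger0_norm//; lra.
have [Cq bnu] := entropy_smear_bounded mq q0 q1 ient ilog mulog dq.
have [Cu bchi] := entropy_smear_bounded mu01 u0 u1 uent ulog mulog du.
(* Both entropies lie within [Cq] and [Cu] respectively of the same number, minus the [mu]-integral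
   of [logpot] minus [ln t]; hence they differ by at most [Cq + Cu]. *)
apply/eqP; rewrite eq_le; apply/andP; split; apply: (@liminf0_div_ln_le _ _ _ (Cq + Cu));
  move=> t t0; have [a -> ha] := bnu t t0; have [b -> hb] := bchi t t0.
- exists a, b; split=> //; move: ha hb; rewrite !ler_norml; lra.
- exists b, a; split=> //; move: ha hb; rewrite !ler_norml; lra.
Qed.
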